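(* For every positive integer $r$ and every $\mathbb{Z}$-invariant colouring $c:[\mathbb{Z}]^2\to r$ there exists a $c$-monochromatic set $X\subseteq\mathbb{Z}$ such that, for every $k\geq 1$, $X$ is not $k$-thin.
   Context: Here $r=\{0,1,\ldots,r-1\}$ and $[\mathbb{Z}]^2$ is the set of 2-element subsets of $\mathbb{Z}$. A colouring $c:[\mathbb{Z}]^2\to r$ is $\mathbb{Z}$-invariant if $c(\{x,y\})=c(\{x+z,y+z\})$ for all distinct $x,y\in\mathbb{Z}$ and all $z\in\mathbb{Z}$. A set $X$ is $c$-monochromatic if $c$ is constant on $[X]^2$. A set $A\subseteq\mathbb{Z}$ is $k$-thin if $|(g+A)\cap A|\leq k$ for every $g\in\mathbb{Z}\setminus\{0\}$. *)

(* Defs.v *)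
From mathcomp Require Export all_boot all_order all_algebra.
From mathcomp Require Export finmap.
From mathcomp Require Export boolp classical_sets functions cardinality.

Set Implicit Arguments.
Unset Strict Implicit.
Unset Printing Implicit Defensive.

Import GRing.Theory.

Local Open Scope fset_scope.
Local Open Scope classical_set_scope.
Local Open Scope card_scope.
Local Open Scope ring_scope.

Definition two_subset : Type := {P : {fset int} | #|` P| == 2%N}.

Lemma card_doubleton (x y : int) : x != y -> #|` [fset x; y] | == 2%N.
Proof. by move=> xy; rewrite cardfs2 xy. Qed.

Definition doubleton (x y : int) (xy : x != y) : two_subset :=
  exist _ [fset x; y] (card_doubleton xy).

Lemma shift_neq (x y z : int) : x != y -> x + z != y + z.
Proof. by rewrite (inj_eq (addIr z)). Qed.

Definition Z_invariant (r : nat) (c : two_subset -> 'I_r) : Prop :=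
  forall (x y z : int) (xy : x != y),
    c (doubleton xy) = c (doubleton (shift_neq z xy)).

Definition monochromatic (r : nat) (c : two_subset -> 'I_r) (X : set int) : Prop :=
  exists i : 'I_r, forall P : two_subset, [set` val P] `<=` X -> c P = i.

(* [#<=] is comparison of cardinalities, so an infinite intersection is never
   of size at most k. *)
Definition thin (k : nat) (A : set int) : Prop :=
  forall g : int, g != 0 -> ([set g + a | a in A] `&` A) #<= `I_k.

(* Main.v *)
(** By invariance [c] is a colouring of positive integers (differences).
Call [k]-configuration a set consisting of [g > 0] and all [y j - y i + e * g]
with [i < j <= k] and [e] in {-1, 0, 1}: these are the differences of
{y 1, y 1 + g, ..., y k, y k + g} together with what is needed to translate it by
[- y 0].

Finite colourings have monochromatic configurations: van der Waerden's theorem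
applied to the colouring n |-> (f (j n))_j, followed by Ramsey's theorem, gives
y and d such that all [y j - y i + d t], [|t| <= N], have one colour; either this
colour occurs among the [d t], or the multiples of [d] use one colour less.

The ultrafilters on Z all of whose members contain configurations thus form a
nonempty closed set, and it is a subsemigroup because the elementwise sum of two
configurations is a configuration. By the Ellis-Numakura lemma it contains an
idempotent [p]. Let [D] be the colour class of differences in [p]. As in
Galvin's proof of Hindman's theorem, [X] is built as an increasing union of finite
sets: each step adds a translate, by the largest point [M] so far, of a set
{y j - y 0, y j - y 0 + g} coming from a configuration in a suitable member of [p]. *)
Require Import Defs.
From mathcomp Require Import filter ring zify.

Set Implicit Arguments.
Unset Strict Implicit.
Unset Printing Implicit Defensive.

Import Order.TTheory GRing.Theory Num.Theory.

Local Open Scope classical_set_scope.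
Local Open Scope ring_scope.

(** * Finite Ramsey theory: van der Waerden's theorem and Ramsey's theorem for pairs *)

Section Finite.
Local Open Scope nat_scope.

(* Colour focusing: [a] is the common starting point of the progressions of
   steps [ds], whose terms other than [a] are monochromatic of distinct colours. *)
Lemma focused_progressions (l : nat) (T : finType) :
  (forall T' : finType, exists W, forall f : nat -> T', exists a d,
    [/\ 0 < d, a + l.+1 * d < W &
        forall s, 0 < s <= l.+1 -> f (a + s * d) = f (a + d)]) ->
  forall m, exists W, forall f : nat -> T,
    (exists a d, [/\ 0 < d, a + l.+1 * d < W &
        forall s, s <= l.+1 -> f (a + s * d) = f a]) \/
    (exists a ds, [/\ a < W, size ds = m, uniq [seq f (a + d) | d <- ds] &
        forall d, d \in ds -> [/\ 0 < d, a + l.+1 * d < W &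
          forall s, 0 < s <= l.+1 -> f (a + s * d) = f (a + d)]]).
Proof.
move=> vdW; elim=> [|m [W0 IH]].
  by exists 1 => f; right; exists 0, [::].
have [W1 HW1] := vdW {ffun 'I_W0 -> T}.
exists (W1 + W0) => f.
(* A number is coloured by the pattern of [f] on the block of length [W0] that starts there. *)
have [A [D [D0 AD hA]]] := HW1 (fun n => [ffun i : 'I_W0 => f (n + i)]).
have blocks s i : 0 < s <= l.+1 -> i < W0 -> f (A + s * D + i) = f (A + D + i).
  by move=> hs hi; have /ffunP/(_ (Ordinal hi)) := hA s hs; rewrite !ffunE.
have [[a [d [d0 ad mono]]]|[a [ds [aW sz un hds]]]] :=
    IH (fun n => f (A + D + n)).
  left; exists (A + D + a), d; split=> //; first nia.
  by move=> s /mono <-; congr f; lia.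
have [[d hd fd]|nfd] :=
    pselect (exists2 d, d \in ds & f (A + D + (a + d)) = f (A + D + a)).
  have [d0 ad mono] := hds d hd.
  left; exists (A + D + a), d; split=> //; first nia.
  move=> [|s] hs; first by rewrite mul0n addn0.
  by rewrite -addnA mono.
(* The focus moves back by [D]: step [D] visits the old focus in each block, and step [d + D]
   advances along an old progression by one term per block. *)
right; exists (A + a), (D :: [seq d + D | d <- ds]); split.
- by nia.
- by rewrite /= size_map sz.
- have E d : d \in ds -> f (A + a + (d + D)) = f (A + D + (a + d)).
    by move=> _; congr f; lia.
  have -> : [seq f (A + a + d) | d <- D :: [seq d + D | d <- ds]] =
      f (A + D + a) :: [seq f (A + D + (a + d)) | d <- ds].
    rewrite /= -map_comp; congr (_ :: _); first by congr f; lia.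
    by apply/eq_in_map => d hd /=; exact: E.
  rewrite /= un andbT; apply/negP => /mapP [d hd fd].
  by apply: nfd; exists d.
- move=> d; rewrite inE => /orP [/eqP ->|/mapP [e he ->]].
    split=> //; first lia.
    move=> s hs; have := blocks s a hs aW.
    have -> : A + s * D + a = A + a + s * D by lia.
    by move->; congr f; lia.
  have [e0 ae mono] := hds e he.
  split; [lia|nia|move=> s hs].
  have -> : A + a + s * (e + D) = A + s * D + (a + s * e) by lia.
  rewrite blocks //; last by nia.
  by rewrite mono //; congr f; lia.
Qed.

Theorem van_der_Waerden (l : nat) (T : finType) :
  exists W, forall f : nat -> T, exists a d,
    [/\ 0 < d < W, a + l * d < W & forall s, s <= l -> f (a + s * d) = f a].
Proof.
elim: l T => [|l IH] T.
  exists 2 => f; exists 0, 1; split=> // s; rewrite leqn0 => /eqP ->.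
  by rewrite mul0n.
have step (T' : finType) : exists W, forall f : nat -> T', exists a d,
    [/\ 0 < d, a + l.+1 * d < W &
        forall s, 0 < s <= l.+1 -> f (a + s * d) = f (a + d)].
  have [W HW] := IH T'; exists (W + W) => f.
  have [a [d [/andP[d0 dW] ad mono]]] := HW (fun n => f (W + n)).
  (* Prepending [a - d] shifts the indices by one; working above [W] makes the subtraction exact, as
     [d < W]. *)
  exists (W + a - d), d; split=> //; first nia.
  move=> [//|s] hs.
  have -> : W + a - d + s.+1 * d = W + (a + s * d) by nia.
  by rewrite mono //; congr f; lia.
(* With more progressions than colours, the second alternative is impossible. *)
have [W HW] := focused_progressions T step #|T|.+1.
exists W => f; have [[a [d [d0 ad mono]]]|[a [ds [_ sz un _]]]] := HW f.
  by exists a, d; split=> //; nia.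
have := max_card (mem [seq f (a + d) | d <- ds]).
by rewrite (card_uniqP un) size_map sz ltnn.
Qed.

Lemma pigeonhole_count (A : eqType) (T : finType) (f : A -> T) s k :
  #|T| * k < size s -> exists c, k < count (fun y => f y == c) s.
Proof.
have <- : \sum_(c : T) count (fun y => f y == c) s = size s.
  elim: s => [|x s IHs] /=; first by rewrite big1.
  rewrite big_split /= IHs (bigD1 (f x)) //= eqxx big1 // => c.
  by rewrite eq_sym => /negbTE ->.
move=> h; apply/not_existsP => H; move: h.
rewrite ltnNge -sum_nat_const leq_sum // => c _.
by rewrite leqNgt; apply/negP/H.
Qed.

(** The head [x] is kept, the tail is cut down to a large colour class of [f x], and so on: the
    colour of a pair then depends only on its earlier element. *)
Lemma end_homogeneous_seq (T : finType) m :
  exists K, forall (A : eqType) (f : A -> A -> T) (s : seq A), uniq s -> K <= size s ->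
  exists t (c : A -> T),
    [/\ subseq t s, size t = m & pairwise (fun x y => f x y == c x) t].
Proof.
elim: m => [|m [K IH]].
  (* The bound is 1, not 0, so that [s] has a head [x] and [f x] can serve as [c]. *)
  exists 1 => A f [//|x s] _ _; exists [::], (f x); split=> //; exact: sub0seq.
exists (#|T| * K).+2 => A f [//|x s] /= /andP[xs us]; rewrite ltnS => hs.
have [c hc] : exists c, K <= count (fun y => f x y == c) s.
  by have [c /ltnW] := @pigeonhole_count _ _ (f x) s K hs; exists c.
have [|//|t [c' [ts sz hp]]] := IH A f [seq y <- s | f x y == c].
  exact: filter_uniq.
  by rewrite size_filter.
have tx y : y \in t -> (f x y == c) && (y \in s).
  by move=> /(mem_subseq ts); rewrite mem_filter.
exists (x :: t), (fun y => if y == x then c else c' y); split.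
- by rewrite /= eqxx; apply: subseq_trans ts _; exact: filter_subseq.
- by rewrite /= sz.
- rewrite /= eqxx; apply/andP; split.
    by apply/allP => y /tx /andP[].
  apply: (sub_in_pairwise (P := mem t)) hp; last exact/allP.
  move=> y z /tx /andP[_ ys] _ /=.
  by case: (eqVneq y x) => [yx|//]; rewrite yx (negbTE xs) in ys.
Qed.

Theorem Ramsey_pairs (T : finType) k :
  exists K, forall f : nat -> nat -> T, exists t c,
    [/\ sorted ltn t, {subset t <= gtn K}, size t = k & pairwise (fun x y => f x y == c) t].
Proof.
have [K HK] := end_homogeneous_seq T (#|T| * k).+1.
exists K => f.
have [|t [c [ts sz hp]]] := HK nat f (iota 0 K) (iota_uniq _ _).
  by rewrite size_iota.
have [d hd] : exists d, k <= count (fun y => c y == d) t.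
  have [|d /ltnW] := @pigeonhole_count _ _ c t k.
    by rewrite sz.
  by exists d.
exists (take k [seq y <- t | c y == d]), d; split.
- apply: take_sorted; apply: sorted_filter; first exact: ltn_trans.
  by apply: subseq_sorted ts _; [exact: ltn_trans|exact: iota_ltn_sorted].
- move=> x /mem_take; rewrite mem_filter => /andP[_ /(mem_subseq ts)].
  by rewrite mem_iota.
- by rewrite size_takel // size_filter.
- apply: (@subseq_pairwise _ _ _ [seq y <- t | c y == d]); first exact: take_subseq.
  have hp' : pairwise (fun x y => f x y == c x) [seq y <- t | c y == d].
    by apply: subseq_pairwise hp; exact: filter_subseq.
  apply: (sub_in_pairwise (P := [pred y | c y == d])) hp'.
    by move=> x y /eqP ->.
  by apply/allP => y; rewrite mem_filter => /andP[].
Qed.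

End Finite.

(** * Configurations and their partition regularity *)

Definition has_configuration (k : nat) (B : set int) : Prop :=
  exists (g : int) (y : nat -> int), [/\ 0 < g, B g &
    forall i j, (i < j <= k)%N ->
      [/\ B (y j - y i), B (y j - y i + g) & B (y j - y i - g)]].

Lemma has_configurationS k (A B : set int) :
  A `<=` B -> has_configuration k A -> has_configuration k B.
Proof.
move=> AB [g [y [g0 Ag Ay]]]; exists g, y; split=> //; first exact: AB.
by move=> i j /Ay [? ? ?]; split; exact: AB.
Qed.

Lemma has_configuration_leq k l (A : set int) :
  (k <= l)%N -> has_configuration l A -> has_configuration k A.
Proof.
move=> kl [g [y [g0 Ag Ay]]]; exists g, y; split=> // i j /andP[ij jk].
by apply: Ay; rewrite ij (leq_trans jk).
Qed.

(** A difference has the form [h * a] with [0 < h < K], where [a] is the midpoint of a van der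
    Waerden progression. Since [h] divides $K!$, adding a multiple of $K!$ times the step amounts to
    moving [a] along the progression, which keeps the colour. *)
Lemma dilated_difference_colours (T : finType) (k N : nat) :
  exists M : nat, forall f : int -> T, exists (c : T) (d : int) (y : nat -> int),
    [/\ 0 < d, d * N%:Z <= M%:Z &
        forall i j t, (i < j <= k)%N -> `|t| <= N%:Z ->
          0 < y j - y i + d * t <= M%:Z /\ f (y j - y i + d * t) = c].
Proof.
have [K HK] := Ramsey_pairs T k.+1.
(* With the extra 1, the midpoint stays positive when moved back by $K!\,N$ steps. *)
have [L LE] : exists L, L = (K`! * N).+1 by exists (K`! * N).+1.
have [W HW] := van_der_Waerden (L + L) {ffun 'I_K -> T}.
exists (K * W + W * K`! * N)%N => f.
have [a0 [d [/andP[d0 dW] adW mono]]] :=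
  HW (fun n => [ffun j : 'I_K => f (j%:Z * n%:Z)]).
pose a := (a0 + L * d)%N.
have col h (s : int) : (h < K)%N -> `|s| <= L%:Z ->
    f (h%:Z * (a%:Z + s * d%:Z)) = f (h%:Z * a%:Z).
  move=> hK sL.
  have E n : (n <= L + L)%N -> f (h%:Z * (a0 + n * d)%N%:Z) = f (h%:Z * a0%:Z).
    by move=> nL; have /ffunP/(_ (Ordinal hK)) := mono n nL; rewrite !ffunE.
  rewrite /a [RHS]E; last by lia.
  have [e eE] : exists e : nat, s + L%:Z = e%:Z.
    by exists (absz (s + L%:Z)); lia.
  have -> : (a0 + L * d)%N%:Z + s * d%:Z = (a0 + e * d)%N%:Z.
    by rewrite !PoszD !PoszM -eE; ring.
  by rewrite E //; lia.
have [t [c [srt tK szt hom]]] := HK (fun i j => f ((j%:Z - i%:Z) * a%:Z)).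
exists c, (d * K`!)%N%:Z, (fun i => (nth 0%N t i)%:Z * a%:Z); split.
- by have := fact_gt0 K; nia.
- by rewrite !PoszD !PoszM; nia.
- move=> i j s /andP[ij jk] sN.
  have [ti tj] : (nth 0 t i < nth 0 t j)%N /\ (nth 0 t j < K)%N.
    split; first by apply: (sorted_ltn_nth ltn_trans 0%N srt) => //; rewrite inE szt; lia.
    by apply/tK/mem_nth; rewrite szt; lia.
  pose h := (nth 0 t j - nth 0 t i)%N.
  have hE : (nth 0%N t j)%:Z - (nth 0%N t i)%:Z = h%:Z by lia.
  have h0 : (0 < h)%N by lia.
  have hK : (h < K)%N by lia.
  have /dvdnP [q qE] : (h %| K`!)%N by apply: dvdn_fact; lia.
  have q0 : (0 < q)%N by have := fact_gt0 K; nia.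
  have -> : (nth 0%N t j)%:Z * a%:Z - (nth 0%N t i)%:Z * a%:Z + (d * K`!)%N%:Z * s
      = h%:Z * (a%:Z + (q%:Z * s) * d%:Z).
    by rewrite -mulrBl hE qE !PoszM; ring.
  have qsL : `|q%:Z * s| <= (K`! * N)%N%:Z.
    rewrite qE normrM; nia.
  split.
    have qsd : `|q%:Z * s * d%:Z| <= (K`! * N * d)%N%:Z.
      by rewrite normrM PoszM ler_wpM2r //; lia.
    have [x0 xW] : 0 < a%:Z + q%:Z * s * d%:Z /\ a%:Z + q%:Z * s * d%:Z <= W%:Z.
      by rewrite /a LE in adW *; split; nia.
    apply/andP; split; first nia.
    apply: (@le_trans _ _ (K * W)%N%:Z); last by lia.
    by rewrite PoszM ler_pM //; lia.
  rewrite col //; last by lia.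
  apply/eqP; rewrite -hE.
  have /pairwiseP := hom => /(_ 0%N); apply => //=; rewrite inE szt; lia.
Qed.

Theorem configuration_partition_regular (T : finType) (k : nat) :
  exists N : nat, forall f : int -> T, exists c,
    has_configuration k.+1 [set n | 0 < n <= N%:Z /\ f n = c].
Proof.
suff [N HN] : exists N : nat, forall (f : int -> T) (S : {set T}), (#|S| <= #|T|)%N ->
    (forall n, 0 < n <= N%:Z -> f n \in S) ->
    exists c, has_configuration k.+1 [set n | 0 < n <= N%:Z /\ f n = c].
  exists N => f; apply: (HN f finset.setT); first exact: max_card.
  by move=> n _; rewrite finset.in_setT.
elim: #|T| => [|r [N IH]].
  exists 1%N => f S; rewrite leqn0 cards_eq0 => /eqP -> /(_ 1) /=.
  by rewrite finset.in_set0 => /(_ isT).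
have [M HM] := dilated_difference_colours T k.+1 N.
exists M => f S hS fS.
have [c [d [y [d0 dN hy]]]] := HM f.
have cS : c \in S.
  by have [//|//|h <-] := hy 0%N 1%N 0; exact: fS.
have [[t t0 ft]|nt] :=
    pselect (exists2 t, 0 < t <= N%:Z & f (d * t) = c).
  exists c, (d * t), y; split.
  - by nia.
  - by split=> //; nia.
  - move=> i j ij; split.
    + have := hy i j 0 ij; rewrite mulr0 addr0; apply; lia.
    + by apply: hy => //; lia.
    + by have := hy i j (- t) ij; rewrite mulrN; apply; lia.
have [||c' [g [z [g0 [gN fg] hz]]]] := IH (fun n => f (d * n)) (S :\ c)%SET.
- by move: hS; rewrite (cardsD1 c) cS.
- move=> n hn; rewrite finset.in_setD1; apply/andP; split.
    by apply/eqP => fn; apply: nt; exists n.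
  by apply: fS; nia.
have sub n : 0 < n <= N%:Z /\ f (d * n) = c' -> 0 < d * n <= M%:Z /\ f (d * n) = c'.
  by move=> [hn ->]; split=> //; nia.
exists c', (d * g), (fun i => d * z i); split; [nia|exact: sub|move=> i j /hz [h1 h2 h3]].
by rewrite -mulrBr -mulrDr -mulrBr; split; exact: sub.
Qed.

(** * Sums of filters and of ultrafilters *)

Definition translate_in (V : set_system int) (A : set int) : set int :=
  [set x | V [set y | A (x + y)]].

(** On ultrafilters, the addition of the Stone-Cech compactification of Z, continuous in [U]. For a
    filter [U] and an ultrafilter [V], the filter of the closed set of all [W + V] with [W] above
    [U]. *)
Definition filter_sum (U V : set_system int) : set_system int :=
  [set A | U (translate_in V A)].

Lemma translate_inC V A : UltraFilter V -> translate_in V (~` A) = ~` translate_in V A.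
Proof.
move=> uV; apply/seteqP; split=> x /= hx.
  move=> hA; apply: (@filter_not_empty _ V).
  by apply: filterS (filterI hx hA) => y [].
by case: (in_ultra_setVsetC [set y | A (x + y)] uV).
Qed.

Lemma translate_inS V A B : Filter V -> A `<=` B -> translate_in V A `<=` translate_in V B.
Proof. by move=> fV AB x; apply: filterS => y; exact: AB. Qed.

Lemma translate_inI V A B : Filter V ->
  translate_in V A `&` translate_in V B `<=` translate_in V (A `&` B).
Proof. by move=> fV x [hA hB]; exact: filterI. Qed.

Lemma filter_sum_proper U V :
  ProperFilter U -> ProperFilter V -> ProperFilter (filter_sum U V).
Proof.
move=> pU pV; split.
  rewrite /filter_sum /= => h; apply: (@filter_not_empty _ U).
  by apply: filterS h => x /filter_not_empty.
split.
- by rewrite /filter_sum /=; apply: filterS filterT => x _; exact: filterT.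
- by rewrite /filter_sum => A B /= hA hB; apply: filterS (filterI hA hB); exact: translate_inI.
- by rewrite /filter_sum => A B AB /=; apply: filterS; exact: translate_inS.
Qed.

Lemma ultraP (T : Type) (U : set_system T) : ProperFilter U ->
  (forall A, U A \/ U (~` A)) -> UltraFilter U.
Proof.
move=> pU dec; split=> // G pG UG; apply/seteqP; split=> // A GA.
case: (dec A) => // /UG GnA; exfalso; apply: (@filter_not_empty _ G).
by rewrite -(setICr A); exact: filterI.
Qed.

Lemma filter_sum_ultra U V :
  UltraFilter U -> UltraFilter V -> UltraFilter (filter_sum U V).
Proof.
move=> uU uV; apply: ultraP => [|A]; first exact: filter_sum_proper.
rewrite /filter_sum /= translate_inC //; exact: in_ultra_setVsetC.
Qed.

Lemma filter_sumA U V W :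
  filter_sum (filter_sum U V) W = filter_sum U (filter_sum V W).
Proof.
rewrite /filter_sum /translate_in; apply/seteqP; split=> A /=; congr (U _);
  by apply/funext => x /=; congr V; apply/funext => y /=; congr W;
     apply/funext => z /=; rewrite addrA.
Qed.

(** * Minimal closed subsemigroups and idempotents *)

Lemma ultra_incl_eq (T : Type) (U V : set_system T) :
  UltraFilter U -> ProperFilter V -> U `<=` V -> V = U.
Proof. by move=> uU pV UV; exact: max_filter. Qed.

(** [F] and the complement of [A] generate the proper filter [G]. Hence a filter is the intersection
    of the ultrafilters above it. *)
Lemma ultra_avoiding (T : Type) (F : set_system T) (A : set T) :
  ProperFilter F -> ~ F A -> exists U, [/\ UltraFilter U, F `<=` U & U (~` A)].
Proof.
move=> pF nFA; pose G : set_system T := [set B | F (A `|` B)].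
have pG : ProperFilter G.
  split; first by rewrite /G /= setU0.
  split.
  - by rewrite /G /= setUT; exact: filterT.
  - by move=> B C hB hC; rewrite /G /= setUIr; exact: filterI.
  - by move=> B C BC; rewrite /G /=; apply: filterS; exact: setUS.
have [U [uU GU]] := ultraFilterLemma pG.
exists U; split=> //.
  by move=> B FB; apply: GU; apply: filterS FB; exact: subsetUr.
by apply: GU; rewrite /G /= setUCr; exact: filterT.
Qed.

(* For ultrafilters [U] and [V], the closed set of those [W] above [F] with
   [W + V = U]. *)
Definition right_solutions (F U V : set_system int) : set_system int :=
  [set B | exists C A, [/\ F C, U A & C `&` translate_in V A `<=` B]].

(** If some [C] in [F] missed [translate_in V A] with [A] in [U], the complement of [A] would lie in
    [filter_sum F V], hence in [U]. *)
Lemma right_solutions_proper F U V :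
  ProperFilter F -> ProperFilter U -> UltraFilter V -> filter_sum F V `<=` U ->
  ProperFilter (right_solutions F U V).
Proof.
move=> pF pU uV FVU; split.
  move=> [C [A [FC UA CA]]].
  have : U (~` A).
    apply: FVU; rewrite /filter_sum /= translate_inC //.
    by apply: filterS FC => x Cx Ax; exact: (CA x).
  by move=> UnA; apply: (@filter_not_empty _ U); rewrite -(setICr A); exact: filterI.
split.
- by exists setT, setT; split=> //; exact: filterT.
- move=> B1 B2 [C1 [A1 [FC1 UA1 h1]]] [C2 [A2 [FC2 UA2 h2]]].
  exists (C1 `&` C2), (A1 `&` A2); split; [exact: filterI|exact: filterI|].
  move=> x [[Cx1 Cx2] Ax]; split; [apply: h1|apply: h2]; split=> //;
    by move: Ax; apply: translate_inS => ? [].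
- by move=> B1 B2 B12 [C [A [FC UA h]]]; exists C, A; split=> // x /h /B12.
Qed.

Lemma sub_right_solutions F U V : ProperFilter U -> ProperFilter V ->
  F `<=` right_solutions F U V.
Proof. by move=> pU pV C FC; exists C, setT; split=> //; exact: filterT. Qed.

Lemma right_solutions_translate F U V A : Filter F ->
  U A -> right_solutions F U V (translate_in V A).
Proof. by move=> fF UA; exists setT, A; split=> //; exact: filterT. Qed.

(* A filter stands for the closed set of the ultrafilters that contain it. *)
Definition closed_subsemigroup (F : set_system int) : Prop :=
  ProperFilter F /\ forall U V, UltraFilter U -> UltraFilter V ->
    F `<=` U -> F `<=` V -> F `<=` filter_sum U V.

(** Larger filters are smaller closed sets, so Zorn's lemma for filters yields a minimal closed
    subsemigroup. *)
Lemma maximal_closed_subsemigroup F0 : closed_subsemigroup F0 ->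
  exists F, [/\ closed_subsemigroup F, F0 `<=` F &
    forall G, closed_subsemigroup G -> F `<=` G -> G = F].
Proof.
move=> sF0.
(* Adjoining [F0] makes the empty chain harmless: its union [set0] stands for [F0]. *)
have [Ch Chs tot|A [sA maxA]] :=
    @Zorn_bigcup (set int) [set X | closed_subsemigroup (X `|` F0)].
  pose Y := [set X | exists2 Z, (Ch Z \/ Z = set0) & X = Z `|` F0].
  have YE : \bigcup_(X in Ch) X `|` F0 = \bigcup_(X in Y) X.
    apply/seteqP; split=> [A [[X ChX XA]|FA]|A [_ [Z ChZ ->] [ZA|FA]]].
    - by exists (X `|` F0); [exists X; [left|]|left].
    - by exists (set0 `|` F0); [exists set0; [right|]|right].
    - by case: ChZ ZA => [ChZ ZA|-> //]; left; exists Z.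
    - by right.
  have sY X : Y X -> closed_subsemigroup X.
    by move=> [Z [/Chs sZ|->] ->] //; rewrite set0U.
  have totY X1 X2 : Y X1 -> Y X2 -> X1 `<=` X2 \/ X2 `<=` X1.
    move=> [Z1 [C1|->] ->] [Z2 [C2|->] ->].
    - by have [h|h] := tot _ _ C1 C2; [left|right]; exact: setSU.
    - by right; rewrite set0U; exact: subsetUr.
    - by left; rewrite set0U; exact: subsetUr.
    - by left.
  have YF0 : Y F0 by exists set0; [right|rewrite set0U].
  rewrite /= YE; split; first split.
  - by move=> [X /sY [pX _]]; exact: filter_not_empty.
  - split.
    + by exists F0 => //; case: sF0 => pF _; exact: filterT.
    + move=> A B [X1 Y1 XA] [X2 Y2 XB].
      have [h|h] := totY _ _ Y1 Y2.
        exists X2 => //; have [pX _] := sY _ Y2; apply: filterI => //; exact: h.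
      exists X1 => //; have [pX _] := sY _ Y1; apply: filterI => //; exact: h.
    + by move=> A B AB [X YX XA]; exists X => //; have [pX _] := sY _ YX; exact: filterS XA.
  - move=> U V uU uV hU hV A [X YX XA]; have [_] := sY _ YX; apply=> // B XB.
      by apply: hU; exists X.
    by apply: hV; exists X.
exists (A `|` F0); split=> // G sG AG.
have F0G : F0 `<=` G by apply: subset_trans AG; exact: subsetUr.
have GE : G `|` F0 = G by apply/setUidPl.
apply/seteqP; split=> // X GX; apply: contrapT => nX.
have [] := maxA G; last by rewrite /= GE.
split; first by move=> Z AZ; apply: AG; left.
by move=> GA; apply: nX; left; exact: GA.
Qed.

(** For [V] in a minimal closed subsemigroup [F], both [F + V] and the set of [W] in [F] with
    [W + V = V] are closed subsemigroups inside [F], hence all of [F]. So [V + V = V]. *)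
Theorem idempotent_ultrafilter F0 : closed_subsemigroup F0 ->
  exists p, [/\ UltraFilter p, F0 `<=` p & p `<=` filter_sum p p].
Proof.
move=> /maximal_closed_subsemigroup [F [[pF sF] F0F maxF]].
have [V [uV FV]] := ultraFilterLemma pF.
have FFV : F `<=` filter_sum F V.
  move=> A FA; apply: contrapT => nA.
  have [U [uU FU UnA]] := ultra_avoiding pF nA.
  apply: (@filter_not_empty _ U); rewrite -(setICr (translate_in V A)).
  by apply: filterI => //; exact: (sF U V).
have lift U : UltraFilter U -> filter_sum F V `<=` U ->
    exists W, [/\ UltraFilter W, F `<=` W & U = filter_sum W V].
  move=> uU h; have pJ := right_solutions_proper pF (@ultra_proper _ _ uU) uV h.
  have [W [uW JW]] := ultraFilterLemma pJ.
  exists W; split=> //.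
    by apply: subset_trans JW; exact: sub_right_solutions.
  apply/esym; apply: ultra_incl_eq; first exact: filter_sum_proper.
  by move=> A UA; apply: JW; exact: right_solutions_translate.
have FE : filter_sum F V = F.
  apply: maxF => //; split; first exact: filter_sum_proper.
  move=> U1 U2 uU1 uU2 h1 h2.
  have [W1 [uW1 FW1 ->]] := lift _ uU1 h1.
  have [W2 [uW2 FW2 ->]] := lift _ uU2 h2.
  (* The sum is [((W1 + V) + W2) + V], and [(W1 + V) + W2] is above [F]. *)
  rewrite -filter_sumA => A FA.
  apply: (sF (filter_sum W1 V) W2 _ _ _ _ _ FA) => //; first exact: filter_sum_ultra.
  exact: sF.
have FVV : filter_sum F V `<=` V by rewrite FE.
have JE : right_solutions F V V = F.
  apply: maxF; last exact: sub_right_solutions.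
  split; first exact: right_solutions_proper.
  move=> U1 U2 uU1 uU2 h1 h2 B [C [A [FC VA CAB]]].
  have uS := filter_sum_ultra uU1 uU2.
  apply: filterS CAB _; apply: filterI.
    by apply: (sF U1 U2) => // D FD; [apply: h1|apply: h2]; exact: sub_right_solutions.
  have : U1 (translate_in V A) by apply: h1; exact: right_solutions_translate.
  apply: filterS => x VAx.
  have := h2 _ (@right_solutions_translate F V V _ (@filter_filter _ _ pF) VAx).
  congr U2; apply/funext => y; congr V; apply/funext => z /=; by rewrite addrA.
exists V; split=> //; first exact: subset_trans FV.
move=> A VA; apply: FV; rewrite -JE; exact: right_solutions_translate.
Qed.

(** * Ultrafilters all of whose members contain configurations *)

Definition rich (p : set_system int) : Prop :=
  UltraFilter p /\ forall B k, p B -> has_configuration k.+1 B.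

Lemma rich_ultrafilter_exists : exists p, rich p.
Proof.
(* The dual filter of the ideal of sets with a finite colouring none of whose classes contains a
   configuration of some fixed index. *)
pose F : set_system int := [set A | exists (T : finType) (k : nat) (f : int -> T),
  forall c, ~ has_configuration k.+1 (~` A `&` [set n | f n = c])].
have pF : ProperFilter F.
  split.
    move=> [T [k [f nf]]]; have [N HN] := configuration_partition_regular T k.
    have [c hc] := HN f; apply: (nf c); apply: has_configurationS hc => n [_ fn].
    by split=> //; rewrite setC0.
  split.
  - exists unit, 0%N, (fun=> tt) => c [g [y [_ [+ _] _]]].
    by rewrite setCT.
  - move=> A B [T1 [k1 [f1 n1]]] [T2 [k2 [f2 n2]]].
    (* Outside the intersection, the Boolean is true only on points missing [B] and false only on
       points missing [A]. *)
    exists (T1 * T2 * bool)%type, (maxn k1 k2), (fun n => (f1 n, f2 n, `[< A n >])).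
    move=> [[c1 c2] []] h.
      apply: (n2 c2); apply: has_configuration_leq (_ : (_ <= (maxn k1 k2).+1)%N) _.
        by rewrite ltnS leq_maxr.
      apply: has_configurationS h => n [nAB /= [_ <- /asboolP An]].
      by split=> // Bn; apply: nAB.
    apply: (n1 c1); apply: has_configuration_leq (_ : (_ <= (maxn k1 k2).+1)%N) _.
      by rewrite ltnS leq_maxl.
    by apply: has_configurationS h => n [_ /= [<- _ /asboolP]].
  - move=> A B AB [T [k [f nf]]]; exists T, k, f => c h; apply: (nf c).
    by apply: has_configurationS h => n [nB fn]; split=> // /AB.
have [p [up Fp]] := ultraFilterLemma pF.
exists p; split=> // B k pB; apply: contrapT => nB.
apply: (@filter_not_empty _ p); rewrite -(setICr B); apply: filterI => //.
apply: Fp; exists unit, k, (fun=> tt) => c; rewrite setCK => h; apply: nB.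
by apply: has_configurationS h => n [].
Qed.

(** Elements with equal [i], [j], [e] are added: [(y j - y i + e g) + (z j - z i + e h)]. The second
    configuration is taken in [W], whose members send the whole first one into [A]. *)
Lemma rich_filter_sum U V : rich U -> rich V -> rich (filter_sum U V).
Proof.
move=> [uU rU] [uV rV]; split=> [|A k hA]; first exact: filter_sum_ultra.
have [g [y [g0 gA hy]]] := rU _ k hA.
pose W := [set n | A (g + n) /\ forall ij : 'I_k.+2 * 'I_k.+2, (ij.1 < ij.2)%N ->
  [/\ A (y ij.2 - y ij.1 + n), A (y ij.2 - y ij.1 + g + n)
    & A (y ij.2 - y ij.1 - g + n)]].
have VW : V W.
  apply: filterI => //; apply: filter_forall => -[i j] /=.
  have [ij|nij] := boolP (i < j)%N; last by apply: filterS filterT => n _.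
  have [|h1 h2 h3] := hy i j; first by rewrite ij -ltnS ltn_ord.
  by apply: filterS (filterI h1 (filterI h2 h3)) => n [? [? ?]] _; split.
have [h [z [h0 [hA' _] hz]]] := rV _ k VW.
exists (g + h), (fun i => y i + z i); split=> // [|i j /andP[ij jk]].
  by rewrite addr_gt0.
have ik : (i < k.+2)%N by lia.
have jk' : (j < k.+2)%N by lia.
have hW n : W n -> [/\ A (y j - y i + n), A (y j - y i + g + n)
    & A (y j - y i - g + n)].
  by move=> [_ /(_ (Ordinal ik, Ordinal jk'))]; apply.
have [|/hW[w1 _ _] /hW[_ w2 _] /hW[_ _ w3]] := hz i j; first by rewrite ij.
split.
- by have -> : y j + z j - (y i + z i) = y j - y i + (z j - z i) by ring.
- by have -> : y j + z j - (y i + z i) + (g + h) =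
    y j - y i + g + (z j - z i + h) by ring.
- by have -> : y j + z j - (y i + z i) - (g + h) =
    y j - y i - g + (z j - z i - h) by ring.
Qed.

Lemma filter_all_seq (I : eqType) (T : Type) (F : set_system T) (s : seq I)
    (P : I -> set T) : Filter F ->
  (forall i, i \in s -> F (P i)) -> F [set t | forall i, i \in s -> P i t].
Proof.
move=> fF; elim: s => [|i s IH] h; first by apply: filterS filterT => t _ i; rewrite in_nil.
have hi : F (P i) by apply: h; rewrite mem_head.
have hs : F [set t | forall i, i \in s -> P i t].
  by apply: IH => j js; apply: h; rewrite inE js orbT.
apply: filterS (filterI hi hs) => t [ti ts] j; rewrite inE => /orP[/eqP -> //|]; exact: ts.
Qed.

Lemma rich_idempotent_exists : exists p, rich p /\ p `<=` filter_sum p p.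
Proof.
pose F : set_system int := [set A | forall p, rich p -> p A].
(* Rich ultrafilters form a closed set: a set without configurations lies in no rich [q], so its
   complement lies in [F]. *)
have Frich p : UltraFilter p -> F `<=` p -> rich p.
  move=> up Fp; split=> // B k pB; apply: contrapT => nB.
  apply: (@filter_not_empty _ p); rewrite -(setICr B); apply: filterI => //.
  apply: Fp => q [uq rq]; have [qB|//] := in_ultra_setVsetC B uq.
  by case: nB; exact: rq.
have [|p [up Fp pp]] := @idempotent_ultrafilter F; last by exists p; split=> //; exact: Frich.
split.
  split.
    by have [p rp] := rich_ultrafilter_exists => /(_ p rp); case: rp => up _; exact: filter_not_empty.
  split.
  - by move=> p [up _]; exact: filterT.
  - by move=> A B FA FB p rp; have [up _] := rp; apply: filterI; [exact: FA|exact: FB].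
  - by move=> A B AB FA p rp; have [up _] := rp; apply: filterS (FA p rp).
move=> U V uU uV FU FV A FA; apply: FA.
by apply: rich_filter_sum; exact: Frich.
Qed.

(** * Construction of the monochromatic set *)

Definition derived_set (p : set_system int) (D : set int) : set int :=
  D `&` translate_in p D.

(* The first component of [st] is the largest point of the finite set [st.2]. *)
Definition admissible (E : set int) (st : int * seq int) : Prop :=
  (forall f, f \in st.2 -> f = st.1 \/ E (st.1 - f)) /\
  (forall f f', f \in st.2 -> f' \in st.2 -> [\/ f = f', E (f - f') | E (f' - f)]).

Definition has_repeated_difference (k : nat) (S : set int) : Prop :=
  exists g (x : nat -> int), 0 < g /\
    (forall i, (i <= k)%N -> S (x i) /\ S (x i + g)) /\
    (forall i j, (i < j <= k)%N -> x i < x j).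

Lemma admissible_extension (p : set_system int) (E : set int) k st :
  rich p -> p E -> E `<=` [set n | 0 < n] ->
  (forall x, E x -> p [set y | E (x + y)]) -> admissible E st ->
  exists st', [/\ admissible E st', {subset st.2 <= st'.2} & has_repeated_difference k [set` st'.2]].
Proof.
case: st => M s [up rich_p] pE E0 EE [/= hM hs].
(* [M + n] with [n] in [B] exceeds every old point by an element of [E]. *)
pose B := E `&` [set n | forall f, f \in s -> E (M - f + n)].
have pB : p B.
  apply: filterI => //; apply: filter_all_seq => f /hM [->|/EE //].
  by rewrite subrr; apply: filterS pE => n; rewrite /= add0r.
have [g [y [g0 [Eg _] hy]]] := rich_p _ k pB.
have g_in : g \in [:: 0; g] by rewrite !inE eqxx orbT.
have o_in : 0 \in [:: 0; g] by rewrite mem_head.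
have Ey i j b b' : (i < j <= k.+1)%N -> b \in [:: 0; g] -> b' \in [:: 0; g] ->
    B (y j - y i + (b - b')).
  move=> ij; have [h1 h2 h3] := hy i j ij.
  rewrite !inE => /orP[]/eqP -> /orP[]/eqP ->; rewrite ?subrr ?subr0 ?sub0r ?addr0 //.
(* [y 0] is the base point, placed at [M]; the indices 1 to [k + 1] give [k + 1] pairs at distance
   [g]. *)
pose t := [seq M + (y j - y 0%N) + b | j <- iota 1 k.+1, b <- [:: 0; g]].
have tP f : f \in t -> exists j b,
    [/\ (0 < j <= k.+1)%N, b \in [:: 0; g] & f = M + (y j - y 0%N) + b].
  by move=> /allpairsP [[j b] [+ hb ->]]; rewrite mem_iota => hj; exists j, b; split=> //; lia.
have tI j b : (0 < j <= k.+1)%N -> b \in [:: 0; g] -> M + (y j - y 0%N) + b \in t.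
  by move=> hj hb; apply/allpairsP; exists (j, b); split=> //; rewrite mem_iota /=; lia.
clearbody t.
have lt_t i j b b' : (i < j <= k.+1)%N -> b \in [:: 0; g] -> b' \in [:: 0; g] ->
    E (M + (y j - y 0%N) + b - (M + (y i - y 0%N) + b')).
  move=> ij hb hb'; have [+ _] := Ey i j b b' ij hb hb'.
  by congr E; ring.
have eq_t j : E (M + (y j - y 0%N) + g - (M + (y j - y 0%N) + 0)).
  by move: Eg; congr E; ring.
have st f f' : f \in s -> f' \in t -> E (f' - f).
  move=> fs /tP [j [b [hj hb ->]]].
  have [|_ /(_ f fs)] := Ey 0%N j b 0 _ hb o_in; first lia.
  by rewrite subr0; congr E; ring.
pose M' := M + (y k.+1 - y 0%N) + g.
have M't : M' \in t by apply: tI => //; lia.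
exists (M', s ++ t); split=> /=; first split=> /=.
- move=> f; rewrite mem_cat => /orP[fs|]; first by right; exact: st.
  move=> /tP [j [b [hj hb ->]]].
  have [->|jk] : j = k.+1 \/ (j < k.+1)%N by lia.
    by move: hb; rewrite !inE => /orP[]/eqP ->; [right; exact: eq_t|left].
  by right; apply: lt_t => //; lia.
- move=> f f'; rewrite !mem_cat => /orP[fs|ft] /orP[fs'|ft'].
  + exact: hs.
  + by apply: Or33; exact: st.
  + by apply: Or32; exact: st.
  + have [j [b [hj hb ->]]] := tP _ ft; have [j' [b' [hj' hb' ->]]] := tP _ ft'.
    have [jj'|jj'|<-] := ltngtP j j'.
    * by apply: Or33; apply: lt_t => //; lia.
    * by apply: Or32; apply: lt_t => //; lia.
    * by move: hb hb'; rewrite !inE => /orP[]/eqP -> /orP[]/eqP ->;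
        [apply: Or31|apply: Or33; exact: eq_t|apply: Or32; exact: eq_t|apply: Or31].
- by move=> f fs; rewrite mem_cat fs.
- exists g, (fun i => M + (y i.+1 - y 0%N)); split=> //; split.
    move=> i ik /=; rewrite !mem_cat; split; apply/orP; right.
      by rewrite -[X in X \in _]addr0; apply: tI => //; lia.
    by apply: tI => //; lia.
  move=> i j ij; have [|[/E0 /= + _] _ _] := hy i.+1 j.+1; first lia.
  lia.
Qed.

(** The [g + x i] are [k + 1] distinct points of the intersection. *)
Lemma has_repeated_difference_thin k S :
  has_repeated_difference k S -> ~ thin k S.
Proof.
move=> [g [x [g0 [xS ltx]]]] /(_ g) thinS.
suff : (`I_k.+1 #<= `I_k)%card by rewrite card_le_II ltnn.
apply: card_le_trans (thinS _); last by rewrite gt_eqF.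
have inj : {in `I_k.+1 &, injective (fun i => g + x i)}.
  move=> i j; rewrite !inE /= => ik jk /addrI xij.
  have [ij|ij|//] := ltngtP i j.
    by have := ltx i j; rewrite ij -ltnS jk xij ltxx => /(_ isT).
  by have := ltx j i; rewrite ij -ltnS ik xij ltxx => /(_ isT).
apply: card_le_trans (_ : (fun i => g + x i) @` `I_k.+1 #<= _)%card.
  by have /card_eqPle[] := inj_card_eq inj.
apply: subset_card_le => _ [i ik <-]; have [h1 h2] := xS i ik; split.
  by exists (x i).
by rewrite addrC.
Qed.

Theorem repeated_differences_in_class (p : set_system int) (D : set int) :
  rich p -> p `<=` filter_sum p p -> D `<=` [set n | 0 < n] -> p D ->
  exists X : set int,
    (forall x y, X x -> X y -> [\/ x = y, D (x - y) | D (y - x)]) /\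
    forall k, has_repeated_difference k X.
Proof.
move=> rp pp D0 pD; have [up _] := rp.
(* Idempotence makes [E], unlike [D], satisfy: [E - x] is in [p] for all [x] in [E]. *)
pose E := D `&` translate_in p D.
have pE : p E by apply: filterI => //; exact: pp.
have EE x : E x -> p [set y | E (x + y)].
  move=> [_ Dx]; apply: filterI => //.
  have := pp _ Dx; congr p; apply/funext => y; congr p; apply/funext => z /=.
  by rewrite addrA.
have E0 : E `<=` [set n | 0 < n] by move=> n [/D0].
(* [choice] requires a total step: a state that is not admissible is left unchanged. *)
have next (kst : nat * (int * seq int)) : exists st', admissible E kst.2 ->
    [/\ admissible E st', {subset kst.2.2 <= st'.2} &
        has_repeated_difference kst.1 [set` st'.2]].
  have [adm|nadm] := pselect (admissible E kst.2); last by exists kst.2.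
  by have [st' h] := admissible_extension kst.1 rp pE E0 EE adm; exists st'.
have [f hf] := choice next.
pose st := fix st n := if n is n'.+1 then f (n', st n') else (0, [::]) : int * seq int.
have adm n : admissible E (st n).
  elim: n => [|n IH] /=; first by split=> ?; rewrite in_nil.
  by have [] := hf (n, st n) IH.
have mono m n : (m <= n)%N -> {subset (st m).2 <= (st n).2}.
  elim: n => [|n IH]; first by rewrite leqn0 => /eqP ->.
  rewrite leq_eqVlt => /orP[/eqP -> //|]; rewrite ltnS => /IH mn x /mn.
  by have [_ + _] := hf (n, st n) (adm n); exact.
exists [set x | exists n, x \in (st n).2]; split.
  move=> x y [m xm] [n yn].
  have [_ /(_ x y)] := adm (maxn m n).
  have xmn := mono m (maxn m n) (leq_maxl _ _) x xm.
  have ymn := mono n (maxn m n) (leq_maxr _ _) y yn.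
  by case=> // [->|[Dxy _]|[Dyx _]]; [apply: Or31|apply: Or32|apply: Or33].
move=> k; have [_ _ [g [x [g0 [xS ltx]]]]] := hf (k, st k) (adm k).
exists g, x; split=> //; split=> // i /xS [h1 h2].
by split; exists k.+1.
Qed.

(** * From colours of pairs to colours of differences *)

Theorem theorem6p2 (r : nat) (hr : (0 < r)%N) (c : two_subset -> 'I_r)
    (hc : Z_invariant c) :
  exists X : set int,
    monochromatic c X /\ forall k : nat, (1 <= k)%N -> ~ thin k X.
Proof.
have doubletonE x y x' y' (xy : x != y) (xy' : x' != y') :
    x = x' -> y = y' -> doubleton xy = doubleton xy'.
  by move=> ? ?; apply: val_inj => /=; congr [fset _; _]%fset.
have doubletonC x y (xy : x != y) (yx : y != x) : doubleton xy = doubleton yx.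
  by apply: val_inj; rewrite /= fsetUC.
(* By invariance the colour of a pair depends only on its positive difference; [Ordinal hr] is a
   default value for [n <= 0]. *)
have colour (n : int) : exists i, 0 < n ->
    forall x y (xy : x != y), y - x = n -> c (doubleton xy) = i.
  have [n0|_] := boolP (0 < n); last by exists (Ordinal hr).
  have n0' : 0 != n by rewrite lt_eqF.
  exists (c (doubleton n0')) => _ x y xy yxn.
  rewrite (hc x y (- x) xy); congr c; apply: doubletonE => //.
  by rewrite subrr.
have [chi chiP] := choice colour.
have [p [rp pp]] := rich_idempotent_exists; have [up rich_p] := rp.
(* A set of non-positive integers contains no configuration, as it would have to contain [g > 0]. *)
have p0 : p [set n | 0 < n].
  have [//|/(rich_p _ 0%N) [g [y [g0 ng _]]]] := in_ultra_setVsetC [set n : int | 0 < n] up.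
  by case: ng.
have [i pi] : exists i, p [set n | 0 < n /\ chi n = i].
  apply: contrapT => /forallNP np; apply: (@filter_not_empty _ p).
  have : p [set n | forall i, ~ (0 < n /\ chi n = i)].
    apply: filter_forall => i.
    by have [/np//|] := in_ultra_setVsetC [set n | 0 < n /\ chi n = i] up.
  by move=> /(filterI p0); apply: filterS => n [n0 /(_ (chi n))]; apply.
have [|X [Xcol Xrep]] := repeated_differences_in_class rp pp _ pi.
  by move=> n [].
exists X; split=> [|k _]; last exact: has_repeated_difference_thin.
exists i => P PX.
have [x [y [xy PE]]] : exists x y (xy : x != y), P = doubleton xy.
  case: P {PX} => S S2; have /fset0Pn [x xS] : S != fset0.
    by rewrite -cardfs_gt0 (eqP S2).
  have /cardfs1P [y Sy] : #|` (S `\ x)%fset| == 1%N.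
    by move: S2; rewrite (cardfsD1 x) xS.
  have xy : x != y.
    have : y \in (S `\ x)%fset by rewrite Sy inE.
    by rewrite !inE eq_sym => /andP[].
  exists x, y, xy; apply: val_inj => /=.
  by rewrite -(fsetD1K xS) Sy.
have Xx : X x by apply: PX; rewrite PE /= !inE eqxx.
have Xy : X y by apply: PX; rewrite PE /= !inE eqxx orbT.
rewrite PE; have [xy0|[d0 <-]|[d0 <-]] := Xcol x y Xx Xy.
- by have /eqP := xy.
- have yx : y != x by rewrite eq_sym.
  by rewrite (doubletonC _ _ _ yx); exact: chiP.
- exact: chiP.
Qed.
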